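(* Let $E$ and $F$ be Banach lattices such that the dual space $E'$ is separable and $F$ is order continuous. If a net $(x_{\alpha})\subseteq E$ is $uaw$-convergent to $x\in E$ and a net $(y_{\beta})\subseteq F$ is $uaw$-convergent to $y\in F$, then the double net $(x_{\alpha}\otimes y_{\beta})_{(\alpha,\beta)}$ is $uaw$-convergent to $x\otimes y$ in the Fremlin projective tensor product $E\widehat{\otimes}F$.
   Context: Banach lattices are real; $E'$ denotes the norm dual of $E$, and separable means norm separable. For Archimedean vector lattices $E,F$, the Fremlin tensor product $E\overline{\otimes}F$ is the Archimedean vector lattice containing the algebraic tensor product $E\otimes F$ as a vector subspace, generated by it as a vector lattice, such that $(x,y)\mapsto x\otimes y$ is a lattice bimorphism and every lattice bimorphism from $E\times F$ into an Archimedean vector lattice factors uniquely through a lattice homomorphism on $E\overline{\otimes}F$. For Banach lattices $E,F$, the Fremlin projective tensor product $E\widehat{\otimes}F$ is the Banach lattice obtained as the completion of $E\otimes F$ (equivalently of $E\overline{\otimes}F$, which is a norm-dense vector sublattice) under the positive projective norm $\|\cdot\|_{|\pi|}$, given on $E\overline{\otimes}F$ by $\|u\|_{|\pi|}=\inf\{\sum_{i=1}^n\|x_i\|\|y_i\| : n\in\mathbb N,\ x_i\in E_+,\ y_i\in F_+,\ |u|\le\sum_{i=1}^n x_i\otimes y_i\}$; it is a lattice norm with $\|x\otimes y\|_{|\pi|}=\|x\|\|y\|$. A Banach lattice is order continuous if every net decreasing to $0$ in order is norm convergent to $0$. A net $(x_\alpha)$ in a Banach lattice $X$ is $uaw$-convergent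 (unbounded absolutely weakly convergent) to $x\in X$ if $|x_\alpha-x|\wedge u\to 0$ weakly for every $u\in X_+$. A double net $(x_\alpha\otimes y_\beta)$ is indexed by the pairs $(\alpha,\beta)$ with the product (coordinatewise) direction. *)

(* Defs.v *)
From HB Require Import structures.
From mathcomp Require Import all_boot all_order all_algebra.
From mathcomp Require Import all_classical all_reals all_analysis.
Set Implicit Arguments.
Unset Strict Implicit.
Unset Printing Implicit Defensive.
Import Order.TTheory GRing.Theory Num.Theory.
Import numFieldNormedType.Exports.
Local Open Scope classical_set_scope.
Local Open Scope ring_scope.

(* The order is not inherited from Order.POrder: HB rejects a structure joining
   an order with a norm, because Num.NumDomain already is such a join. *)
HB.mixin Record isVectorLattice (R : realType) E of GRing.Lmodule R E := {
  vl_le : E -> E -> Prop ;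
  vl_join : E -> E -> E ;
  vl_meet : E -> E -> E ;
  vl_le_refl : forall x, vl_le x x ;
  vl_le_anti : forall x y, vl_le x y -> vl_le y x -> x = y ;
  vl_le_trans : forall x y z, vl_le x y -> vl_le y z -> vl_le x z ;
  vl_joinP : forall x y z, vl_le (vl_join x y) z <-> vl_le x z /\ vl_le y z ;
  vl_meetP : forall x y z, vl_le z (vl_meet x y) <-> vl_le z x /\ vl_le z y ;
  vl_leD2l : forall z x y, vl_le x y -> vl_le (z + x) (z + y) ;
  vl_leZ2l : forall (a : R) x y, 0 <= a -> vl_le x y -> vl_le (a *: x) (a *: y)
}.

#[short(type="vectorLatticeType")]
HB.structure Definition VectorLattice (R : realType) :=
  { E of isVectorLattice R E & GRing.Lmodule R E }.

Declare Scope vlattice_scope.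
Delimit Scope vlattice_scope with VL.
Notation "x <= y" := (vl_le x y) : vlattice_scope.
Notation "x \vee y" := (vl_join x y)
  (at level 50, left associativity) : vlattice_scope.
Notation "x \wedge y" := (vl_meet x y)
  (at level 48, left associativity) : vlattice_scope.

(* `|x| is the norm; the lattice modulus is [modulus x]. *)
Definition modulus (R : realType) (E : vectorLatticeType R) (x : E) : E :=
  (x \vee (- x))%VL.

HB.mixin Record isLatticeNormed (R : realType) E
    of CompleteNormedModule R E & VectorLattice R E := {
  bl_norm_le : forall x y : E, (modulus x <= modulus y)%VL -> `|x| <= `|y|
}.

#[short(type="banachLatticeType")]
HB.structure Definition BanachLattice (R : realType) :=
  { E of isLatticeNormed R E & CompleteNormedModule R E & VectorLattice R E }.

Record directedSet := DirectedSet {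
  dir_sort :> Type ;
  dir_le : dir_sort -> dir_sort -> Prop ;
  dir_le_refl : forall a, dir_le a a ;
  dir_le_trans : forall a b c, dir_le a b -> dir_le b c -> dir_le a c ;
  dir_inhabited : inhabited dir_sort ;
  dir_upper : forall a b, exists c, dir_le a c /\ dir_le b c
}.

Section prod_directed.
Variables I J : directedSet.
Let le (p q : I * J) := dir_le p.1 q.1 /\ dir_le p.2 q.2.

Fact prod_dir_refl p : le p p.
Proof. by split; apply: dir_le_refl. Qed.

Fact prod_dir_trans p q r : le p q -> le q r -> le p r.
Proof.
by move=> [pq1 pq2] [qr1 qr2]; split; [exact: dir_le_trans qr1|
  exact: dir_le_trans qr2].
Qed.

Fact prod_dir_inhabited : inhabited (I * J).
Proof. by have [i] := dir_inhabited I; have [j] := dir_inhabited J. Qed.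

Fact prod_dir_upper p q : exists r, le p r /\ le q r.
Proof.
have [i [pi qi]] := dir_upper p.1 q.1; have [j [pj qj]] := dir_upper p.2 q.2.
by exists (i, j).
Qed.

Definition prod_directed : directedSet :=
  DirectedSet prod_dir_refl prod_dir_trans prod_dir_inhabited prod_dir_upper.

End prod_directed.

(* A net is a function on a directed set; it converges to l when it does so
   along the filter generated by the tails {b | a <= b}. *)
Definition tails (I : directedSet) : set_system I :=
  filter_from [set: I] (fun a => [set b | dir_le a b]).
Arguments tails : clear implicits.

#[global] Instance tails_proper_filter (I : directedSet) :
  ProperFilter (tails I).
Proof.
apply: filter_from_proper; last by move=> a _; exists a; exact: dir_le_refl.
apply: filter_from_filter; first by have [i] := dir_inhabited I; exists i.
move=> a b _ _; have [c [ac bc]] := dir_upper a b; exists c => // d /= cd.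
by split; [exact: dir_le_trans cd|exact: dir_le_trans cd].
Qed.

Section normed_dual.
Variables (R : realType) (E : normedModType R).

Definition norm_dual : set (E -> R) := [set f : E -> R | scalar f /\ continuous f].

Definition dual_norm (f : E -> R) : R :=
  sup [set `|f x| | x in [set x : E | `|x| <= 1]].

Definition dual_separable : Prop :=
  exists D : set (E -> R), [/\ countable D, D `<=` norm_dual &
    forall f, norm_dual f -> forall e : R, 0 < e ->
      exists2 g, D g & dual_norm (f \- g) < e].

Definition weakly_cvg (I : directedSet) (x_ : I -> E) (x : E) : Prop :=
  forall f, norm_dual f -> f (x_ i) @[i --> tails I] --> f x.

End normed_dual.

Section banach_lattice.
Variables (R : realType) (E : banachLatticeType R).

Definition decreasing_to0 (I : directedSet) (x_ : I -> E) : Prop :=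
  [/\ forall i j, dir_le i j -> (x_ j <= x_ i)%VL,
      forall i, (0 <= x_ i)%VL &
      forall z, ((forall i, z <= x_ i) -> z <= 0)%VL].

Definition order_continuous : Prop :=
  forall (I : directedSet) (x_ : I -> E),
    decreasing_to0 x_ -> x_ i @[i --> tails I] --> (0 : E).

Definition uaw_cvg (I : directedSet) (x_ : I -> E) (x : E) : Prop :=
  forall u : E, (0 <= u)%VL ->
    weakly_cvg (fun i => (modulus (x_ i - x) \wedge u)%VL) 0.

End banach_lattice.

Definition bilinear_map (R : realType) (U V W : lmodType R)
    (b : U -> V -> W) : Prop :=
  (forall v, linear (b^~ v)) /\ (forall u, linear (b u)).

Definition is_algebraic_tensor (R : realType) (U V A : lmodType R)
    (t : U -> V -> A) : Prop :=
  bilinear_map t /\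
  forall (W : lmodType R) (b : U -> V -> W), bilinear_map b ->
    exists! f : A -> W, linear f /\ forall u v, f (t u v) = b u v.

Section vector_lattice.
Variable R : realType.
Implicit Types E F G T : vectorLatticeType R.

Definition archimedean E : Prop :=
  forall x y : E, ((forall n : nat, x *+ n <= y) -> x <= 0)%VL.

Definition lattice_hom E F (f : E -> F) : Prop :=
  [/\ linear f,
      forall x y, f (x \vee y)%VL = (f x \vee f y)%VL &
      forall x y, f (x \wedge y)%VL = (f x \wedge f y)%VL].

Definition lattice_bimorphism E F G (b : E -> F -> G) : Prop :=
  [/\ bilinear_map b,
      forall x, (0 <= x)%VL -> lattice_hom (b x) &
      forall y, (0 <= y)%VL -> lattice_hom (b^~ y)].

Definition vector_sublattice T (S : set T) : Prop :=
  [/\ S 0,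
      forall (a : R) u v, S u -> S v -> S (a *: u + v),
      forall u v, S u -> S v -> S (u \vee v)%VL &
      forall u v, S u -> S v -> S (u \wedge v)%VL].

Definition is_fremlin_tensor E F T (t : E -> F -> T) : Prop :=
  [/\ archimedean T,
      lattice_bimorphism t,
      exists (A : lmodType R) (tA : E -> F -> A) (i : A -> T),
        [/\ is_algebraic_tensor tA, linear i, injective i &
            forall x y, i (tA x y) = t x y],
      forall S : set T, vector_sublattice S ->
        (forall x y, S (t x y)) -> S = setT &
      forall G (b : E -> F -> G), archimedean G -> lattice_bimorphism b ->
        exists! f : T -> G, lattice_hom f /\ forall x y, f (t x y) = b x y].

End vector_lattice.

Section fremlin_projective.
Variables (R : realType) (E F : banachLatticeType R).

Definition positive_projective_norm (T : vectorLatticeType R)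
    (t : E -> F -> T) (u : T) : R :=
  inf [set s : R | exists (n : nat) (x : 'I_n -> E) (y : 'I_n -> F),
    [/\ forall i, (0 <= x i)%VL, forall i, (0 <= y i)%VL,
        (modulus u <= (\sum_(i < n) t (x i) (y i))%R)%VL &
        s = \sum_(i < n) `|x i| * `|y i| ]].

(* The tensor products are determined up to isomorphism by their universal
   property, resp. by being a completion: P, with the map t, is the Fremlin
   projective tensor product when some Fremlin tensor product T embeds in P as
   a norm-dense vector sublattice (through j) on which the norm of P is the
   positive projective norm. *)
Definition is_fremlin_projective_tensor (P : banachLatticeType R)
    (t : E -> F -> P) : Prop :=
  exists (T : vectorLatticeType R) (t0 : E -> F -> T) (j : T -> P),
    [/\ is_fremlin_tensor t0,
        lattice_hom j /\ injective j,
        forall u, `|j u| = positive_projective_norm t0 u,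
        dense (range j) &
        forall x y, t x y = j (t0 x y)].

End fremlin_projective.

(* Main.v *)
(* For positive elements, a vector lattice analogue of
   min(st, 1) <= min(s, 1) + min(t, 1) gives
     (a (x) b) /\ (c (x) d) <= 2 ((a /\ c) (x) d + c (x) (b /\ d)).
   Every element of the tensor product lies below some c (x) d + |v| with v of
   arbitrarily small norm, so it suffices to test unbounded convergence against
   the elements c (x) d.  The modulus of a continuous functional is a
   positive continuous functional g, and z |-> g (z (x) d), z |-> g (c (x) z)
   lie in E' and F'; hence the right-hand side tends weakly to 0. *)
Require Import Defs.
From HB Require Import structures.
From mathcomp Require Import all_boot all_order all_algebra.
From mathcomp Require Import all_classical all_reals all_analysis.
From mathcomp Require Import lra.
Set Implicit Arguments.
Unset Strict Implicit.
Unset Printing Implicit Defensive.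
Import Order.TTheory GRing.Theory Num.Theory.
Import numFieldNormedType.Exports.
Local Open Scope classical_set_scope.
Local Open Scope ring_scope.

Arguments vl_le_refl {R s} x.
Arguments vl_le_anti {R s} [x y].
Arguments vl_le_trans {R s} [x y z].
Arguments vl_joinP {R s} {x y z}.
Arguments vl_meetP {R s} {x y z}.
Arguments vl_leD2l {R s} z [x y].
Arguments vl_leZ2l {R s} [a x y].

(** * Order and modulus calculus in vector lattices *)

Section vector_lattice_theory.
Variables (R : realType) (E : vectorLatticeType R).
Implicit Types a b c u v w x y z : E.
Local Open Scope vlattice_scope.

Lemma vl_leDr z x y : x <= y -> x + z <= y + z.
Proof. by move=> xy; rewrite ![_ + z]addrC; exact: vl_leD2l. Qed.

Lemma vl_leD x y u v : x <= y -> u <= v -> x + u <= y + v.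
Proof. by move=> xy uv; apply: vl_le_trans (vl_leDr u xy) (vl_leD2l y uv). Qed.

Lemma vl_subr_ge0 x y : 0 <= y - x <-> x <= y.
Proof.
split=> [/(vl_leDr x)|/(vl_leDr (- x))]; first by rewrite add0r subrK.
by rewrite subrr.
Qed.

Lemma vl_leBlDr x y z : x - y <= z <-> x <= z + y.
Proof.
split=> [/(vl_leDr y)|/(vl_leDr (- y))]; first by rewrite subrK.
by rewrite addrK.
Qed.

Lemma vl_leN2 x y : x <= y -> - y <= - x.
Proof. by move=> /vl_subr_ge0 xy; apply/vl_subr_ge0; rewrite opprK addrC. Qed.

Lemma vl_addr_ge0 x y : 0 <= x -> 0 <= y -> 0 <= x + y.
Proof. by move=> x0 y0; rewrite -[0]addr0; exact: vl_leD. Qed.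

Lemma vl_leDwr x y : 0 <= y -> x <= x + y.
Proof. by move=> y0; rewrite -{1}[x]addr0; exact: vl_leD2l. Qed.

Lemma vl_leDwl x y : 0 <= y -> x <= y + x.
Proof. by rewrite addrC; exact: vl_leDwr. Qed.

Lemma vl_meet_lel x y : x \wedge y <= x.
Proof. by have /vl_meetP[] := vl_le_refl (x \wedge y). Qed.

Lemma vl_meet_ler x y : x \wedge y <= y.
Proof. by have /vl_meetP[] := vl_le_refl (x \wedge y). Qed.

Lemma vl_join_gel x y : x <= x \vee y.
Proof. by have /vl_joinP[] := vl_le_refl (x \vee y). Qed.

Lemma vl_join_ger x y : y <= x \vee y.
Proof. by have /vl_joinP[] := vl_le_refl (x \vee y). Qed.

Lemma vl_meet_ge0 x y : 0 <= x -> 0 <= y -> 0 <= x \wedge y.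
Proof. by move=> x0 y0; apply/vl_meetP. Qed.

Lemma vl_leI2 x y u v : x <= u -> y <= v -> x \wedge y <= u \wedge v.
Proof.
move=> xu yv; apply/vl_meetP; split.
  exact: vl_le_trans (vl_meet_lel _ _) xu.
exact: vl_le_trans (vl_meet_ler _ _) yv.
Qed.

Lemma vl_meet_idl x y : x <= y -> x \wedge y = x.
Proof.
move=> xy; apply: vl_le_anti; first exact: vl_meet_lel.
by apply/vl_meetP; split=> //; exact: vl_le_refl.
Qed.

(** Translation by [x] is an order isomorphism, so it carries lower bounds of [u] and [v] to lower
    bounds of their translates. *)
Lemma vl_le_addI z x u v : z <= x + u -> z <= x + v -> z <= x + (u \wedge v).
Proof.
move=> zu zv; rewrite [x + _]addrC; apply/vl_leBlDr/vl_meetP.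
by split; apply/vl_leBlDr; rewrite [_ + x]addrC.
Qed.

(** Unfolding the meets on the right leaves the sums [b + a], [b + c] and [a \wedge c + c]. The
    first is [a + b]; the other two dominate [c] by positivity. *)
Lemma vl_meetDl a b c : 0 <= a -> 0 <= b -> 0 <= c ->
  (a + b) \wedge c <= a \wedge c + b \wedge c.
Proof.
have cP z : 0 <= z -> (a + b) \wedge c <= z + c.
  by move=> z0; apply: vl_le_trans (vl_meet_ler _ _) (vl_leDwl _ z0).
move=> a0 b0 c0; apply: vl_le_addI; last exact/cP/vl_meet_ge0.
rewrite [X in _ <= X]addrC; apply: vl_le_addI; last exact: cP.
by rewrite [b + a]addrC; exact: vl_meet_lel.
Qed.

Lemma vl_meetC x y : x \wedge y = y \wedge x.
Proof.
by apply: vl_le_anti; apply/vl_meetP; split;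
  [exact: vl_meet_ler|exact: vl_meet_lel|exact: vl_meet_ler|exact: vl_meet_lel].
Qed.

Lemma vl_meetDr a b c : 0 <= a -> 0 <= b -> 0 <= c ->
  a \wedge (b + c) <= a \wedge b + a \wedge c.
Proof. by move=> *; rewrite ![a \wedge _]vl_meetC; exact: vl_meetDl. Qed.

(** Adding [m] back to a lower bound of the two remainders gives a lower bound of [x] and [y], hence
    something below [m]. *)
Lemma vl_meet_sub_disjoint x y :
  (x - x \wedge y) \wedge (y - x \wedge y) <= 0.
Proof.
set m := x \wedge y; set z := _ \wedge _.
suff /(vl_leDr (- m)) : z + m <= m by rewrite addrK subrr.
apply/vl_meetP; split; rewrite -[X in _ <= X](subrK m); apply: vl_leDr.
  exact: vl_meet_lel.
exact: vl_meet_ler.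
Qed.

Lemma vl_addxx_ge0 x : 0 <= x + x -> 0 <= x.
Proof.
move=> x0; have -> : x = (2^-1 : R) *: (x + x).
  by rewrite -mulr2n -(scaler_nat 2 x) scalerA mulVf ?scale1r ?pnatr_eq0.
by rewrite -[X in X <= _](scaler0 E (2^-1 : R)); apply: vl_leZ2l;
  rewrite ?invr_ge0 ?ler0n.
Qed.

Lemma vl_le_modulus x : x <= modulus x.
Proof. exact: vl_join_gel. Qed.

Lemma vl_leN_modulus x : - x <= modulus x.
Proof. exact: vl_join_ger. Qed.

Lemma modulus_leP x z : modulus x <= z <-> x <= z /\ - x <= z.
Proof. exact: vl_joinP. Qed.

Lemma modulus_ge0 x : 0 <= modulus x.
Proof.
apply: vl_addxx_ge0; rewrite -(subrr x).
exact: vl_leD (vl_le_modulus x) (vl_leN_modulus x).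
Qed.

Lemma modulusN x : modulus (- x) = modulus x.
Proof.
have le z : modulus (- z) <= modulus z.
  apply/modulus_leP; rewrite opprK.
  by split; [exact: vl_leN_modulus|exact: vl_le_modulus].
by apply: vl_le_anti => //; rewrite -{1}[x]opprK.
Qed.

Lemma modulusD x y : modulus (x + y) <= modulus x + modulus y.
Proof.
apply/modulus_leP; rewrite opprD.
by split; apply: vl_leD; (exact: vl_le_modulus || exact: vl_leN_modulus).
Qed.

Lemma ge0_modulus x : 0 <= x -> modulus x = x.
Proof.
move=> x0; apply: vl_le_anti; last exact: vl_le_modulus.
apply/modulus_leP; split; first exact: vl_le_refl.
by apply: vl_le_trans (x0); rewrite -[0]oppr0; exact: vl_leN2.
Qed.

Lemma modulusZ (k : R) x : modulus (k *: x) <= `|k|%R *: modulus x.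
Proof.
apply/modulus_leP; rewrite -scaleNr; split;
  case: (real_ge0P (num_real k)) => k0; rewrite ?normrN.
- by apply: vl_leZ2l => //; exact: vl_le_modulus.
- rewrite -[k in X in X <= _]opprK scaleNr -scalerN; apply: vl_leZ2l.
    by rewrite oppr_ge0 ltW.
  exact: vl_leN_modulus.
- by rewrite scaleNr -scalerN; apply: vl_leZ2l => //; exact: vl_leN_modulus.
- by apply: vl_leZ2l; [rewrite oppr_ge0 ltW|exact: vl_le_modulus].
Qed.

Lemma riesz_decomposition w x y : modulus w <= x + y -> 0 <= x -> 0 <= y ->
  exists u v, [/\ w = u + v, modulus u <= x & modulus v <= y].
Proof.
move=> /modulus_leP[wxy Nwxy] x0 y0.
have Nx0 : - x <= 0 by rewrite -[0]oppr0; exact: vl_leN2.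
(* [u] truncates [w] to the order interval from [- x] to [x]; since [w] lies between [- (x + y)] and
   [x + y], what is cut off has modulus at most [y]. *)
pose u := (w \wedge x) \vee (- x); exists u, (w - u); split.
- by rewrite addrC subrK.
- apply/modulus_leP; split.
    apply/vl_joinP; split; first exact: vl_meet_ler.
    exact: vl_le_trans Nx0 x0.
  by rewrite -[x]opprK; apply/vl_leN2/vl_join_ger.
apply/modulus_leP; split.
  apply/vl_leBlDr; rewrite addrC; apply/vl_leBlDr.
  apply: vl_le_trans (vl_join_gel _ _); apply/vl_meetP.
  by split; apply/vl_leBlDr; [exact: vl_leDwr|].
rewrite opprB; apply/vl_leBlDr/vl_joinP; split.
  exact: vl_le_trans (vl_meet_lel _ _) (vl_leDwl _ y0).
rewrite -[- x]add0r; apply/vl_leBlDr; rewrite addrC addrA.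
by move/vl_subr_ge0: Nwxy; rewrite opprK.
Qed.

End vector_lattice_theory.

(** * Lattice homomorphisms and inequalities for lattice bimorphisms *)

Lemma lattice_hom_ge0 (R : realType) (E F : vectorLatticeType R)
    (h : E -> F) x : lattice_hom h ->
  (0 <= x)%VL -> (0 <= h x)%VL.
Proof.
move=> [hL _ hI] x0; have h0 : h 0 = 0.
  by have := hL (-1) 0 0; rewrite scaler0 addr0 scaleN1r addNr.
by rewrite -h0 -(vl_meet_idl x0) hI h0; exact: vl_meet_ler.
Qed.

Lemma lattice_hom_comp_bimorphism (R : realType)
    (E F G H : vectorLatticeType R) (b : E -> F -> G)
    (h : G -> H) : lattice_bimorphism b -> lattice_hom h ->
  lattice_bimorphism (fun x y => h (b x y)).
Proof.
move=> [[bl br] bE bF] [hL hU hI]; split.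
- by split=> [v k u w|u k v w]; rewrite ?bl ?br hL.
- move=> x /bE[_ U I]; split=> [k u v|u v|u v]; first by rewrite br hL.
    by rewrite U hU.
  by rewrite I hI.
- move=> x /bF[_ U I]; split=> [k u v|u v|u v]; first by rewrite bl hL.
    by rewrite U hU.
  by rewrite I hI.
Qed.

Section bimorphism_theory.
Variables (R : realType) (E F G : vectorLatticeType R) (b : E -> F -> G).
Hypothesis hb : lattice_bimorphism b.

Lemma bimorphismDl x x' y : b (x + x') y = b x y + b x' y.
Proof.
by have [[bl _] _ _] := hb; have := bl y 1 x x'; rewrite !scale1r.
Qed.

Lemma bimorphismDr x y y' : b x (y + y') = b x y + b x y'.
Proof.
by have [[_ br] _ _] := hb; have := br x 1 y y'; rewrite !scale1r.
Qed.

Lemma bimorphism0l y : b 0 y = 0.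
Proof. by apply: (addrI (b 0 y)); rewrite -bimorphismDl !addr0. Qed.

Lemma bimorphism0r x : b x 0 = 0.
Proof. by apply: (addrI (b x 0)); rewrite -bimorphismDr !addr0. Qed.

Lemma bimorphismNl x y : b (- x) y = - b x y.
Proof.
by apply: (addrI (b x y)); rewrite -bimorphismDl !subrr bimorphism0l.
Qed.

Lemma bimorphismNr x y : b x (- y) = - b x y.
Proof.
by apply: (addrI (b x y)); rewrite -bimorphismDr !subrr bimorphism0r.
Qed.

Lemma bimorphismBl x x' y : b (x - x') y = b x y - b x' y.
Proof. by rewrite bimorphismDl bimorphismNl. Qed.

Lemma bimorphismBr x y y' : b x (y - y') = b x y - b x y'.
Proof. by rewrite bimorphismDr bimorphismNr. Qed.

Local Open Scope vlattice_scope.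

Lemma bimorphism_ge0 x y : 0 <= x -> 0 <= y -> 0 <= b x y.
Proof. by have [_ bE _] := hb; move=> /bE; exact: lattice_hom_ge0. Qed.

Lemma bimorphism_le x x' y y' : 0 <= x -> x <= x' -> 0 <= y -> y <= y' ->
  b x y <= b x' y'.
Proof.
move=> x0 xx' y0 yy'; apply: (vl_le_trans (y := b x' y)).
  apply/vl_subr_ge0; rewrite -bimorphismBl; apply: bimorphism_ge0 => //.
  exact/vl_subr_ge0.
apply/vl_subr_ge0; rewrite -bimorphismBr; apply: bimorphism_ge0.
  exact: vl_le_trans xx'.
exact/vl_subr_ge0.
Qed.

Lemma bimorphism_meetl x x' y : 0 <= y ->
  b x y \wedge b x' y = b (x \wedge x') y.
Proof. by have [_ _ bF] := hb; move=> /bF[_ _ ->]. Qed.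

Lemma bimorphism_meetr x y y' : 0 <= x ->
  b x y \wedge b x y' = b x (y \wedge y').
Proof. by have [_ bE _] := hb; move=> /bE[_ _ ->]. Qed.

(** Twice the gap [b (modulus z) (modulus y) - b z y] is a sum of two values of [b] at positive
    arguments. The bound for [- b x y] comes from replacing [x] by [- x]. *)
Lemma modulus_bimorphism_le x y : modulus (b x y) <= b (modulus x) (modulus y).
Proof.
have le z : b z y <= b (modulus z) (modulus y).
  apply/vl_subr_ge0/vl_addxx_ge0.
  have -> : b (modulus z) (modulus y) - b z y +
            (b (modulus z) (modulus y) - b z y) =
            b (modulus z - z) (modulus y + y) +
            b (modulus z + z) (modulus y - y).
    rewrite !(bimorphismDl, bimorphismDr, bimorphismNl, bimorphismNr).
    set p := b _ (modulus y); set q := b z y.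
    set r := b _ y; set s := b z _.
    rewrite [RHS]addrACA [p + r + _]addrACA subrr addr0.
    by rewrite [- s - q + _]addrACA addNr add0r addrACA.
  have subge0 (V : vectorLatticeType R) (v : V) : 0 <= modulus v - v.
    exact/vl_subr_ge0/vl_le_modulus.
  have addge0 (V : vectorLatticeType R) (v : V) : 0 <= modulus v + v.
    by rewrite -{2}[v]opprK; apply/vl_subr_ge0/vl_leN_modulus.
  by apply: vl_addr_ge0; apply: bimorphism_ge0.
apply/modulus_leP; split=> //; rewrite -bimorphismNl -(modulusN x); exact: le.
Qed.

(** Both second arguments may be enlarged to [y + y']; with a common positive second argument, [b]
    preserves the meet of the first ones. *)
Lemma bimorphism_disjointl x x' y y' : 0 <= x -> 0 <= x' -> 0 <= y -> 0 <= y' ->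
  x \wedge x' <= 0 -> b x y \wedge b x' y' <= 0.
Proof.
move=> x0 x'0 y0 y'0 xx'; have yy'0 := vl_addr_ge0 y0 y'0.
apply: (vl_le_trans (y := b x (y + y') \wedge b x' (y + y'))).
  apply: vl_leI2; apply: bimorphism_le => //; try exact: vl_le_refl.
    exact: vl_leDwr.
  exact: vl_leDwl.
rewrite bimorphism_meetl// -(bimorphism0l (y + y')).
apply: bimorphism_le => //; last exact: vl_le_refl.
exact: vl_meet_ge0.
Qed.

Lemma bimorphism_disjointr x x' y y' : 0 <= x -> 0 <= x' -> 0 <= y -> 0 <= y' ->
  y \wedge y' <= 0 -> b x y \wedge b x' y' <= 0.
Proof.
move=> x0 x'0 y0 y'0 yy'; have xx'0 := vl_addr_ge0 x0 x'0.
apply: (vl_le_trans (y := b (x + x') y \wedge b (x + x') y')).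
  apply: vl_leI2; apply: bimorphism_le => //; try exact: vl_le_refl.
    exact: vl_leDwr.
  exact: vl_leDwl.
rewrite bimorphism_meetr// -(bimorphism0r (x + x')).
apply: bimorphism_le => //; first exact: vl_le_refl.
exact: vl_meet_ge0.
Qed.

(** The element [b c d] is covered by [r] and [b (c - m) (d - n)], and the latter meets [b x y] in
    at most [b m n], which is again below [r]: one copy of [r] from each piece gives the factor
    2. *)
Lemma bimorphism_meet_le x y c d : 0 <= x -> 0 <= y -> 0 <= c -> 0 <= d ->
  b x y \wedge b c d <=
    (b (x \wedge c) d + b c (y \wedge d)) *+ 2.
Proof.
move=> x0 y0 c0 d0; set m := x \wedge c; set n := y \wedge d.
have m0 : 0 <= m by exact: vl_meet_ge0.
have n0 : 0 <= n by exact: vl_meet_ge0.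
have xm0 : 0 <= x - m by apply/vl_subr_ge0/vl_meet_lel.
have cm0 : 0 <= c - m by apply/vl_subr_ge0/vl_meet_ler.
have yn0 : 0 <= y - n by apply/vl_subr_ge0/vl_meet_lel.
have dn0 : 0 <= d - n by apply/vl_subr_ge0/vl_meet_ler.
have cmdn0 := bimorphism_ge0 cm0 dn0.
set r := b m d + b c n.
have r0 : 0 <= r by apply: vl_addr_ge0; exact: bimorphism_ge0.
have cd_le : b c d <= r + b (c - m) (d - n).
  have -> : r + b (c - m) (d - n) = b c d + b m n.
    rewrite bimorphismBl !bimorphismBr /r.
    rewrite opprB [b c d - _ + _]addrACA -opprD [b c n + _]addrC.
    by rewrite [LHS]addrC subrK.
  exact/vl_leDwr/bimorphism_ge0.
have mn_le : b m n <= r.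
  apply: (vl_le_trans (y := b m d)); last first.
    exact: vl_leDwr (bimorphism_ge0 c0 n0).
  by apply: bimorphism_le => //; [exact: vl_le_refl|exact: vl_meet_ler].
(* Split [b x y] into [b (x - m) y], [b m (y - n)] and [b m n]; the first two are disjoint from
   [b (c - m) (d - n)], in the first and in the second variable respectively. *)
have xy_le : b x y \wedge b (c - m) (d - n) <= b m n.
  rewrite -[x in b x y](subrK m) [b _ y]bimorphismDl.
  apply: (vl_le_trans (vl_meetDl _ _ _)) => //; try exact: bimorphism_ge0.
  rewrite -[X in _ <= X]add0r; apply: vl_leD.
    by apply: bimorphism_disjointl => //; exact: vl_meet_sub_disjoint.
  rewrite -[y in b m y](subrK n) [b m _]bimorphismDr.
  apply: (vl_le_trans (vl_meetDl _ _ _)) => //; try exact: bimorphism_ge0.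
  rewrite -[X in _ <= X]add0r; apply: vl_leD; last exact: vl_meet_lel.
  by apply: bimorphism_disjointr => //; exact: vl_meet_sub_disjoint.
apply: (vl_le_trans (vl_leI2 (vl_le_refl _) cd_le)).
apply: (vl_le_trans (vl_meetDr _ _ _)) => //; try exact: bimorphism_ge0.
rewrite mulr2n; apply: vl_leD; first exact: vl_meet_ler.
exact: vl_le_trans xy_le mn_le.
Qed.

(* With x' y' - x y = (x' - x)(y' - y) + (x' - x) y + x (y' - y), the bounds
   |x| <= c and |y| <= d reduce the last two terms to a meet in one variable. *)
Lemma bimorphism_sub_meet_le x x' y y' c d : modulus x <= c -> modulus y <= d ->
  modulus (b x' y' - b x y) \wedge b c d <=
    (b (modulus (x' - x) \wedge c) d + b c (modulus (y' - y) \wedge d)) *+ 3.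
Proof.
move=> xc yd; set p := modulus (x' - x); set q := modulus (y' - y).
have p0 : 0 <= p := modulus_ge0 _; have q0 : 0 <= q := modulus_ge0 _.
have c0 : 0 <= c := vl_le_trans (modulus_ge0 _) xc.
have d0 : 0 <= d := vl_le_trans (modulus_ge0 _) yd.
have cd0 := bimorphism_ge0 c0 d0.
have pq0 := bimorphism_ge0 p0 q0; have pd0 := bimorphism_ge0 p0 d0.
have cq0 := bimorphism_ge0 c0 q0; have pdcq0 := vl_addr_ge0 pd0 cq0.
have sub_le : modulus (b x' y' - b x y) <= b p q + (b p d + b c q).
  have -> : b x' y' - b x y =
      b (x' - x) (y' - y) + (b (x' - x) y + b x (y' - y)).
    rewrite addrA -bimorphismDr subrK bimorphismBl bimorphismBr.
    by rewrite addrA subrK.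
  apply: (vl_le_trans (modulusD _ _)).
  apply: vl_leD; first exact: modulus_bimorphism_le.
  apply: (vl_le_trans (modulusD _ _)).
  apply: vl_leD; apply: (vl_le_trans (modulus_bimorphism_le _ _));
    by apply: bimorphism_le => //; (exact: modulus_ge0 || exact: vl_le_refl).
apply: (vl_le_trans (vl_leI2 sub_le (vl_le_refl _))).
apply: (vl_le_trans (vl_meetDl _ _ _)) => //.
rewrite mulrSr; apply: vl_leD; first exact: bimorphism_meet_le.
apply: (vl_le_trans (vl_meetDl _ _ _)) => //.
by rewrite bimorphism_meetl// bimorphism_meetr//; exact: vl_le_refl.
Qed.

End bimorphism_theory.

(** * Continuous functionals as bounded functionals *)

Section norm_dual_theory.
Variables (R : realType) (E : normedModType R) (f : E -> R).

Lemma scalarD u v : scalar f -> f (u + v) = f u + f v.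
Proof. by move=> fL; have := fL 1 u v; rewrite scale1r mul1r. Qed.

Lemma scalar0 : scalar f -> f 0 = 0.
Proof. by move=> fL; apply: (addrI (f 0)); rewrite -scalarD// !addr0. Qed.

Lemma scalarZ a u : scalar f -> f (a *: u) = a * f u.
Proof. by move=> fL; have := fL a u 0; rewrite scalar0// !addr0. Qed.

Lemma scalarN u : scalar f -> f (- u) = - f u.
Proof. by move=> fL; rewrite -scaleN1r scalarZ// mulN1r. Qed.

Lemma norm_dual_bounded : norm_dual f ->
  exists2 K : R, 0 <= K & forall x, `|f x| <= K * `|x|.
Proof.
move=> [fL fC].
pose fM := GRing.isLinear.Build R E R *%R f fL.
pose g : {scalar E} := HB.pack f fM.
have /(linear_boundedP (W := R^o)) [M [Mr MP]] : bounded_near g (nbhs (0 : E)).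
  by apply: (@continuous_linear_bounded R E R^o 0 g); exact: fC.
(* Boundedness near infinity allows every constant strictly above [M], hence [M + 1]; the maximum
   makes the constant nonnegative. *)
exists (Num.max (M + 1) 0); first by rewrite le_max lexx orbT.
by apply: MP; rewrite lt_max ltrDl ltr01.
Qed.

Lemma bounded_norm_dual (K : R) :
  scalar f -> (forall x, `|f x| <= K * `|x|) -> norm_dual f.
Proof.
move=> fL fK; split=> //.
pose fM := GRing.isLinear.Build R E R *%R f fL.
pose g : {scalar E} := HB.pack f fM.
apply: (@bounded_linear_continuous R E R^o g).
apply/(linear_boundedP (W := R^o)).
exists K; split; first exact: num_real.
move=> r Kr x; apply: le_trans (fK x) _.
by apply: ler_wpM2r => //; exact: ltW.
Qed.

End norm_dual_theory.

(** * Lattice norms and the modulus of a continuous functional *)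

Section banach_lattice_theory.
Variables (R : realType) (E : banachLatticeType R).
Implicit Types (f g : E -> R) (x y z u v w : E).

Lemma norm_modulus x : `|modulus x| = `|x|.
Proof.
have mm : modulus (modulus x) = modulus x := ge0_modulus (modulus_ge0 x).
by apply/eqP; rewrite eq_le !bl_norm_le// mm; exact: vl_le_refl.
Qed.

Lemma ge0_le_norm x y : (modulus x <= y)%VL -> `|x| <= `|y|.
Proof.
move=> xy; apply: bl_norm_le; exact: vl_le_trans xy (vl_le_modulus y).
Qed.

(** Riesz-Kantorovich construction: on the positive cone the modulus of [f] is the supremum [cone],
    which Riesz decomposition makes additive; it is then extended to [E] by differences. *)
Lemma norm_dual_modulus f : norm_dual f ->
  exists g, [/\ norm_dual g, forall x, (0 <= x)%VL -> 0 <= g x &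
    forall x, `|f x| <= g (modulus x)].
Proof.
move=> fd; have [fL _] := fd; have [K K0 fK] := norm_dual_bounded fd.
pose cone z := sup [set f w | w in [set w | (modulus w <= z)%VL]].
have mod0 : modulus (0 : E) = 0 by apply: ge0_modulus; exact: vl_le_refl.
have memP z w : (modulus w <= z)%VL -> f w <= K * `|z|.
  move=> wz; apply: le_trans (ler_norm _) (le_trans (fK w) _).
  by apply: ler_wpM2l => //; exact: ge0_le_norm.
have ubP z : has_ubound [set f w | w in [set w | (modulus w <= z)%VL]].
  by exists (K * `|z|) => _ [w /= wz <-]; exact: memP.
have f_le z w : (modulus w <= z)%VL -> f w <= cone z.
  by move=> wz; apply: ub_le_sup => //; exists w.
have ge_cone z r : (0 <= z)%VL ->
    (forall w, (modulus w <= z)%VL -> f w <= r) -> cone z <= r.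
  move=> z0 zr; apply: ge_sup => [|_ [w /= wz <-]]; last exact: zr.
  by exists (f 0), 0 => //=; rewrite mod0.
have cone_ge0 z : (0 <= z)%VL -> 0 <= cone z.
  by move=> z0; rewrite -(scalar0 fL); apply: f_le; rewrite mod0.
have cone_le z : (0 <= z)%VL -> cone z <= K * `|z|.
  by move=> z0; apply: ge_cone => // w; exact: memP.
have coneD x y : (0 <= x)%VL -> (0 <= y)%VL ->
    cone (x + y) = cone x + cone y.
  move=> x0 y0; apply/eqP; rewrite eq_le; apply/andP; split.
    apply: ge_cone => [|w wxy]; first exact: vl_addr_ge0.
    have [u [v [-> ux vy]]] := riesz_decomposition wxy x0 y0.
    by rewrite scalarD//; apply: lerD; exact: f_le.
  (* Superadditivity: the two suprema are taken one after the other, with [u] fixed during the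
     second. *)
  rewrite -lerBrDr; apply: (ge_cone) => // u ux; rewrite lerBrDr -lerBrDl.
  apply: ge_cone => // v vy; rewrite lerBrDl -scalarD//; apply: f_le.
  exact: vl_le_trans (modulusD u v) (vl_leD ux vy).
have coneZ_le a x : 0 < a -> (0 <= x)%VL -> cone (a *: x) <= a * cone x.
  move=> a0 x0; apply: ge_cone => [|w wax].
    by rewrite -(scaler0 E a); apply: vl_leZ2l => //; exact: ltW.
  have -> : w = a *: (a^-1 *: w) by rewrite scalerA divff ?scale1r ?gt_eqF.
  rewrite scalarZ//; apply: ler_wpM2l; first exact: ltW.
  apply: f_le; apply: vl_le_trans (modulusZ _ _) _.
  rewrite ger0_norm ?invr_ge0 ?ltW//.
  rewrite -[x]scale1r -(mulVf (lt0r_neq0 a0)) -scalerA.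
  by apply: vl_leZ2l; rewrite ?invr_ge0 ?ltW.
have coneZ a x : 0 <= a -> (0 <= x)%VL -> cone (a *: x) = a * cone x.
  rewrite le_eqVlt => /orP[/eqP<-|a0] x0.
    rewrite scale0r mul0r; apply/eqP; rewrite eq_le cone_ge0 ?andbT.
      by rewrite (le_trans (cone_le _ _)) ?normr0 ?mulr0//; exact: vl_le_refl.
    exact: vl_le_refl.
  apply/eqP; rewrite eq_le coneZ_le//=.
  (* The reverse inequality is [coneZ_le] for the factor [a^-1] at the vector [a *: x]. *)
  rewrite -ler_pdivlMl// -{1}[x]scale1r -(mulVf (lt0r_neq0 a0)) -scalerA.
  apply: coneZ_le; first by rewrite invr_gt0.
  by rewrite -(scaler0 E a); apply: vl_leZ2l => //; exact: ltW.
(* Any difference of positive elements representing x would do; this one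
   avoids positive parts. *)
pose g x := cone (modulus x + x) - cone (modulus x).
have m0 := @modulus_ge0 R E.
have mx0 x : (0 <= modulus x + x)%VL.
  by rewrite -{2}[x]opprK; apply/vl_subr_ge0/vl_leN_modulus.
(* Independence of the representation as a difference, from which the linearity of [g] follows. *)
have gE x y : (0 <= x)%VL -> (0 <= y)%VL -> g (x - y) = cone x - cone y.
  move=> x0 y0; apply/eqP; rewrite /g subr_eq addrAC eq_sym subr_eq.
  rewrite -!coneD ?m0 ?mx0//; apply/eqP; congr cone.
  by rewrite -addrA subrK addrC.
have gpos x : (0 <= x)%VL -> g x = cone x.
  move=> x0; rewrite -[x in LHS]subr0 gE//; last exact: vl_le_refl.
  by rewrite -(scale0r 0) coneZ ?mul0r ?subr0//; exact: vl_le_refl.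
have splitx x : x = (modulus x + x) - modulus x by rewrite addrAC subrr add0r.
have gD x y : g (x + y) = g x + g y.
  rewrite {1}(splitx x) {1}(splitx y) addrACA -opprD gE; try exact: vl_addr_ge0.
  rewrite (coneD _ _ (mx0 x) (mx0 y)).
  by rewrite (coneD _ _ (m0 x) (m0 y)) opprD addrACA.
have gN x : g (- x) = - g x.
  by rewrite {1}(splitx x) opprB gE// opprB.
have gZ0 a x : 0 <= a -> g (a *: x) = a * g x.
  move=> a0; rewrite {1}(splitx x) scalerBr gE;
    try by rewrite -(scaler0 E a); exact: vl_leZ2l.
  by rewrite !coneZ// mulrBr.
have gZ a x : g (a *: x) = a * g x.
  case: (real_ge0P (num_real a)) => a0; first exact: gZ0.
  rewrite -[a]opprK scaleNr gN gZ0 ?mulNr//.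
  by rewrite oppr_ge0 ltW.
exists g; split.
(* In [3 K], two units bound [cone (modulus x + x)] and one bounds [cone (modulus x)]. *)
- apply: (@bounded_norm_dual _ _ _ (K *+ 3)) => [a u v|x].
    by rewrite gD gZ.
  apply: le_trans (ler_normB _ _) _.
  rewrite !ger0_norm ?cone_ge0//.
  rewrite mulrSr mulrDl; apply: lerD; last first.
    by apply: le_trans (cone_le _ _) _; rewrite ?norm_modulus.
  apply: le_trans (cone_le _ _) _ => //.
  rewrite mulr2n mulrDl -mulrDr; apply: ler_wpM2l => //.
  by apply: le_trans (ler_normD _ _) _; rewrite norm_modulus.
- by move=> x x0; rewrite gpos// cone_ge0.
move=> x; rewrite gpos// ler_norml lerNl -(scalarN x fL).
by rewrite !f_le ?modulusN//; exact: vl_le_refl.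
Qed.

End banach_lattice_theory.

(** * Majorants, norm and slices in Fremlin tensor products *)

Section fremlin_tensor_theory.
Variable R : realType.

(** The elements with such a majorant form a vector sublattice containing all elementary tensors,
    and these tensors generate [T]. *)
Lemma fremlin_tensor_majorized (E F T : vectorLatticeType R)
    (t : E -> F -> T) w :
  is_fremlin_tensor t ->
  exists c d, [/\ 0 <= c, 0 <= d & modulus w <= t c d]%VL.
Proof.
move=> [_ ht _ gen _].
pose S := [set w | exists c d, [/\ 0 <= c, 0 <= d & modulus w <= t c d]%VL].
suff : S w by [].
suff -> : S = setT by [].
(* Two majorants merge into one, as [t c d + t c' d'] lies below [t (c + c') (d + d')]; every
   sublattice operation then reduces to a bound by [modulus u + modulus v]. *)
have SD u v r : S u -> S v ->
    (modulus r <= modulus u + modulus v)%VL -> S r.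
  move=> [c [d [c0 d0 uP]]] [c' [d' [c'0 d'0 vP]]] rP.
  exists (c + c'), (d + d'); split; try exact: vl_addr_ge0.
  apply: vl_le_trans rP _; rewrite (bimorphismDl ht); apply: vl_leD.
    apply: (vl_le_trans uP); apply: bimorphism_le => //.
      exact: vl_le_refl.
    exact: vl_leDwr.
  apply: (vl_le_trans vP); apply: bimorphism_le => //.
    exact: vl_le_refl.
  exact: vl_leDwl.
have modl (u v : T) : (u <= modulus u + modulus v)%VL.
  exact: vl_le_trans (vl_le_modulus u) (vl_leDwr _ (modulus_ge0 v)).
have modr (u v : T) : (u <= modulus v + modulus u)%VL.
  by rewrite addrC.
have Nmodl (u v : T) : (- u <= modulus u + modulus v)%VL.
  by rewrite -(modulusN u).
have Nmodr (u v : T) : (- u <= modulus v + modulus u)%VL.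
  by rewrite addrC.
apply: gen => [|x y]; last first.
  exists (modulus x), (modulus y); split; try exact: modulus_ge0.
  exact: modulus_bimorphism_le.
split.
- exists 0, 0; rewrite (bimorphism0l ht) ge0_modulus; last exact: vl_le_refl.
  by split; exact: vl_le_refl.
- move=> a u v [c [d [c0 d0 uP]]] Sv.
  apply: (SD (a *: u) v) => //; last exact: modulusD.
  exists (`|a| *: c), d; split=> //.
    by rewrite -(scaler0 E `|a|); exact: vl_leZ2l.
  have -> : t (`|a| *: c) d = `|a| *: t c d.
    have [[tl _] _ _] := ht.
    by have := tl d `|a| c 0; rewrite (bimorphism0l ht) !addr0.
  exact: vl_le_trans (modulusZ _ _) (vl_leZ2l (normr_ge0 a) uP).
- move=> u v Su Sv; apply: SD Su Sv _; apply/modulus_leP; split.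
    exact/vl_joinP.
  by apply: (vl_le_trans (vl_leN2 (vl_join_gel u v))).
- move=> u v Su Sv; apply: SD Su Sv _; apply/modulus_leP; split.
    exact: vl_le_trans (vl_meet_lel u v) _.
  have Nr (r z : T) : (- z <= r)%VL -> (- r <= z)%VL.
    by move=> /vl_leN2; rewrite opprK.
  rewrite -[modulus u + modulus v]opprK; apply/vl_leN2/vl_meetP.
  by split; apply: Nr.
Qed.

Variables (E F P : banachLatticeType R) (t : E -> F -> P).
Hypothesis ht : is_fremlin_projective_tensor t.

Lemma fremlin_projective_bimorphism : lattice_bimorphism t.
Proof.
have [T [t0 [j [[_ t0b _ _ _] [jh _] _ _ tE]]]] := ht.
rewrite (_ : t = fun x y => j (t0 x y)).
  exact: lattice_hom_comp_bimorphism.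
by apply/funext => x; apply/funext => y.
Qed.

(** The one-term sum with [modulus x] and [modulus y] is admissible in the infimum defining the
    norm, and that infimum is over a set bounded below by 0. *)
Lemma fremlin_projective_norm_le x y : `|t x y| <= `|x| * `|y|.
Proof.
have [T [t0 [j [[_ t0b _ _ _] _ jN _ tE]]]] := ht.
rewrite tE jN; apply: inf_lbound.
  exists 0 => _ [n [a [b [_ _ _ ->]]]].
  by apply: sumr_ge0 => i _; rewrite mulr_ge0.
exists 1%N, (fun=> modulus x), (fun=> modulus y).
rewrite !big_ord1 !norm_modulus; split=> //; try by move=> _; exact: modulus_ge0.
exact: modulus_bimorphism_le.
Qed.

(** By density [u] is within [e] of some [j w]; a majorant of [w] serves for the approximation, and
    [v] is the error [u - j w]. *)
Lemma fremlin_projective_majorized u (e : R) : 0 < e ->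
  exists c d v, [/\ 0 <= c, 0 <= d & u <= t c d + modulus v]%VL /\ `|v| < e.
Proof.
move=> e0; have [T [t0 [j [t0T [jh _] _ jD tE]]]] := ht.
have [_ [[w _ <-] /= uw]] : (range j `&` ball u e) !=set0.
  rewrite setIC; apply: jD; last exact: ball_open.
  by exists u; exact: ballxx.
have [c [d [c0 d0 wcd]]] := fremlin_tensor_majorized w t0T.
exists c, d, (u - j w); split; last by move: uw; rewrite -ball_normE.
split=> //; rewrite -{1}(subrK (j w) u) addrC; apply: vl_leD.
  have [jL _ _] := jh; rewrite tE; apply/vl_subr_ge0.
  have -> : j (t0 c d) - j w = j (t0 c d - w).
    by rewrite addrC -scaleN1r -jL scaleN1r addrC.
  apply: lattice_hom_ge0 => //; apply/vl_subr_ge0.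
  exact: vl_le_trans (vl_le_modulus w) wcd.
exact: vl_le_modulus.
Qed.

(** The norm bound on elementary tensors makes the slice bounded; such slices turn weak convergence
    in a factor into convergence of [g] on tensors. *)
Lemma norm_dual_tensorl g d : norm_dual g -> norm_dual (fun z => g (t z d)).
Proof.
move=> gd; have [gL _] := gd; have [K K0 gK] := norm_dual_bounded gd.
have [[tl _] _ _] := fremlin_projective_bimorphism.
apply: (@bounded_norm_dual _ _ _ (K * `|d|)) => [a u v|x].
  by rewrite tl gL.
apply: (le_trans (gK _)); rewrite -mulrA [`|d| * _]mulrC.
by apply: ler_wpM2l => //; exact: fremlin_projective_norm_le.
Qed.

Lemma norm_dual_tensorr g c : norm_dual g -> norm_dual (fun z => g (t c z)).
Proof.
move=> gd; have [gL _] := gd; have [K K0 gK] := norm_dual_bounded gd.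
have [[_ tr] _ _] := fremlin_projective_bimorphism.
apply: (@bounded_norm_dual _ _ _ (K * `|c|)) => [a u v|y].
  by rewrite tr gL.
apply: (le_trans (gK _)); rewrite -mulrA.
by apply: ler_wpM2l => //; exact: fremlin_projective_norm_le.
Qed.

End fremlin_tensor_theory.

(** * Convergence of the double net *)

Theorem theorem13 (R : realType) (E F P : banachLatticeType R)
    (tensor : E -> F -> P) (hP : is_fremlin_projective_tensor tensor)
    (hE : dual_separable E) (hF : order_continuous F)
    (I J : directedSet) (x_ : I -> E) (x : E) (y_ : J -> F) (y : F)
    (hx : uaw_cvg x_ x) (hy : uaw_cvg y_ y) :
  uaw_cvg (I := prod_directed I J) (fun p => tensor (x_ p.1) (y_ p.2))
    (tensor x y).
Proof.
move=> u u0 f fd; have [g [gd g0 fg]] := norm_dual_modulus fd.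
have [[fL _] [gL _]] := (fd, gd); have [K K0 gK] := norm_dual_bounded gd.
have tb := fremlin_projective_bimorphism hP.
have g_le v w : (v <= w)%VL -> g v <= g w.
  move=> vw; rewrite -subr_ge0 -scalarN// -scalarD//.
  exact/g0/vl_subr_ge0.
rewrite scalar0//; apply/cvgr0Pnorm_lt => e e0.
(* This radius makes [K * |v|] at most [e / 2]; the added 1 covers [K = 0]. *)
have del0 : 0 < e / (2 * K + 1) by rewrite divr_gt0// ltr_wpDl// mulr_ge0.
have [c [d [v [[c0 d0 u_le] v_lt]]]] := fremlin_projective_majorized hP u del0.
(* Enlarging [c] and [d] keeps the majorant of [u] and gives [modulus x <= cx], [modulus y <= dy],
   as [bimorphism_sub_meet_le] requires. *)
set cx := c + modulus x; set dy := d + modulus y.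
have cx0 : (0 <= cx)%VL by apply: vl_addr_ge0 => //; exact: modulus_ge0.
have dy0 : (0 <= dy)%VL by apply: vl_addr_ge0 => //; exact: modulus_ge0.
(* Two terms, each counted three times, then total less than [e / 2]. *)
have e12 : 0 < e / 12 by rewrite divr_gt0.
have /cvgr0Pnorm_lt /(_ _ e12) [a _ xP] :
    g (tensor (modulus (x_ i - x) \wedge cx)%VL dy) @[i --> tails I] --> (0 : R).
  have := hx cx cx0 _ (norm_dual_tensorl hP dy gd).
  by rewrite (bimorphism0l tb) scalar0.
have /cvgr0Pnorm_lt /(_ _ e12) [b _ yP] :
    g (tensor cx (modulus (y_ i - y) \wedge dy)%VL) @[i --> tails J] --> (0 : R).
  have := hy dy dy0 _ (norm_dual_tensorr hP cx gd).
  by rewrite (bimorphism0r tb) scalar0.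
exists (a, b) => // -[i k] [/= /xP xi /yP yk].
set s := modulus _; have s0 : (0 <= s)%VL := modulus_ge0 _.
apply: le_lt_trans (fg _) _; rewrite ge0_modulus; last exact: vl_meet_ge0.
have u_le' : (u <= tensor cx dy + modulus v)%VL.
  apply: (vl_le_trans u_le); apply/vl_leDr/bimorphism_le => //;
    by apply: vl_leDwr; exact: modulus_ge0.
have v0 := modulus_ge0 v.
(* The meet with [u] splits into the meet with [tensor cx dy], controlled by the two one-variable
   nets, and an error below [modulus v]. *)
have su_le : (s \wedge u <=
    (tensor (modulus (x_ i - x) \wedge cx) dy +
     tensor cx (modulus (y_ k - y) \wedge dy)) *+ 3 + modulus v)%VL.
  apply: (vl_le_trans (vl_leI2 (vl_le_refl _) u_le')).
  apply: (vl_le_trans (vl_meetDr _ _ _)) => //; first exact: bimorphism_ge0.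
  apply: vl_leD; last exact: vl_meet_ler.
  by apply: bimorphism_sub_meet_le => //; apply: vl_leDwl.
apply: le_lt_trans (g_le _ _ su_le) _.
rewrite mulrSr mulr2n !(scalarD _ _ gL).
move: xi yk => /(le_lt_trans (ler_norm _)) xi /(le_lt_trans (ler_norm _)) yk.
have gv : g (modulus v) <= e / 2.
  apply: le_trans (ler_norm _) (le_trans (gK _) _); rewrite norm_modulus.
  apply: le_trans (ler_wpM2l K0 (ltW v_lt)) _.
  rewrite mulrCA ler_pM2l// ler_pdivrMr; lra.
lra.
Qed.
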